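(* Let $N,n\ge1$, $\alpha,\beta>-1$, and let $\mathcal{L}=a^N(x)\frac{d^N}{dx^N}+\dots+a^1(x)\frac{d}{dx}+a^0(x)$ on $[-1,1]$ with smooth coefficients and $a^N(x)\neq0$. Consider the Petrov--Galerkin spectral method with trial functions $\phi^J_k$, test functions $\psi^J_k$ ($0\le k\le n-1$) given by $$(\phi^J_0|\cdots|\phi^J_{n-1})=(J^{(\alpha,\beta)}_0|\cdots|J^{(\alpha,\beta)}_{n+N-1})R^J,\qquad(\psi^J_0|\cdots|\psi^J_{n-1})=(J^{(\alpha+N,\beta+N)}_0|\cdots|J^{(\alpha+N,\beta+N)}_{n+N-1})Q^J,$$ where $R^J,Q^J$ are the $(n+N)\times n$ stencil matrices, and with weight $\omega^{(\alpha+N,\beta+N)}$. Then its coefficient matrix $A^J$, with entries $A^J(i,j)=(\psi^J_i,\mathcal{L}\phi^J_j)_{\omega^{(\alpha+N,\beta+N)}}$, satisfies $$A^J=(Q^J)^T\,\Omega^J_{n+N-1}\,L^J_{n+N-1}\,R^J,$$ where $$\Omega^J_{n+N-1}=\operatorname{diag}(d^J_0,\dots,d^J_{n+N-1}),\qquad d^J_j=\frac{2^{\alpha+\beta+2N+1}\,\Gamma(j+\alpha+N+1)\,\Gamma(j+\beta+N+1)}{(2j+\alpha+\beta+2N+1)\,j!\,\Gamma(j+\alpha+\beta+2N+1)},$$ and $$L^J_{n+N-1}=\mathcal{P}_{n+N-1}\Big(\mathcal{M}^J_N[a^N]\mathcal{D}^J_N+\sum_{k=0}^{N-1}\mathcal{S}^J_{N-1}\cdots\mathcal{S}^J_k\,\mathcal{M}^J_k[a^k]\,\mathcal{D}^J_k\Big)\mathcal{P}_{n+N-1}^{\top},$$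 with $\mathcal{D}^J_0=\mathcal{I}$ and $\mathcal{P}_{n+N-1}=(I_{n+N},0)$ the projection onto the first $n+N$ components (indices $0,\dots,n+N-1$).
   Context: $J^{(\alpha,\beta)}_j$ is the classical Jacobi polynomial of degree $j$ (standard normalization $J_j^{(\alpha,\beta)}(1)=\binom{j+\alpha}{j}$), orthogonal on $[-1,1]$ with weight $\omega^{(\alpha,\beta)}(x)=(1-x)^\alpha(1+x)^\beta$. $(f,g)_\omega=\int_{-1}^1fg\,\omega\,dx$. Indices of rows and columns start at $0$; $(f_0|f_1|\cdots)M$ is the list of functions whose $j$th member is $\sum_if_iM_{ij}$. The stencil matrices $R^J$ and $Q^J$ are real matrices giving the coefficients of the recombined Jacobi polynomials used as trial and test functions. The infinite matrices (for $k\ge0$, except $\mathcal{D}^J_k$ for $k\ge1$) are determined by their actions: - $\frac{d^k}{dx^k}(J^{(\alpha,\beta)}_0|J^{(\alpha,\beta)}_1|\cdots)=(J^{(\alpha+k,\beta+k)}_0|J^{(\alpha+k,\beta+k)}_1|\cdots)\mathcal{D}^J_k$; explicitly the only nonzero entries of $\mathcal{D}^J_k$ are $(\mathcal{D}^J_k)_{j,j+k}=\frac{1}{2^k}\frac{\Gamma(\alpha+\beta+2k+j+1)}{\Gamma(\alpha+\beta+k+j+1)}$, $j\ge0$. - $h(x)(J^{(\alpha+k,\beta+k)}_0|J^{(\alpha+k,\beta+k)}_1|\cdots)=(J^{(\alpha+k,\beta+k)}_0|J^{(\alpha+k,\beta+k)}_1|\cdots)\mathcal{M}^J_k[h]$,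 i.e. column $j$ of $\mathcal{M}^J_k[h]$ contains the $J^{(\alpha+k,\beta+k)}$-expansion coefficients of $hJ^{(\alpha+k,\beta+k)}_j$. - $(J^{(\alpha+k,\beta+k)}_0|J^{(\alpha+k,\beta+k)}_1|\cdots)=(J^{(\alpha+k+1,\beta+k+1)}_0|J^{(\alpha+k+1,\beta+k+1)}_1|\cdots)\mathcal{S}^J_k$; $\mathcal{S}^J_k$ is upper triangular with nonzero entries only on the main diagonal and the first two superdiagonals. Smooth means infinitely differentiable on $[-1,1]$. *)

(* Defs.v *)
From HB Require Import structures.
From mathcomp Require Import all_boot all_order all_algebra.
From mathcomp Require Import all_classical all_reals all_analysis.

Set Implicit Arguments.
Unset Strict Implicit.
Unset Printing Implicit Defensive.

Import Order.TTheory GRing.Theory Num.Theory.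
Import numFieldNormedType.Exports.

Local Open Scope classical_set_scope.
Local Open Scope ring_scope.

(** Euler's integral; it is only ever evaluated at positive arguments. *)
Definition Gamma (R : realType) (z : R) : R :=
  \int[@lebesgue_measure R]_(t in `]0, +oo[) (t `^ (z - 1) * expR (- t)).

(** Binomial coefficient with a real upper argument. *)
Definition gbinomial (R : realType) (z : R) (j : nat) : R :=
  (\prod_(i < j) (z - i%:R)) / j`!%:R.

Definition jacobi_weight (R : realType) (a b x : R) : R :=
  (1 - x) `^ a * (1 + x) `^ b.

Definition weighted_dot (R : realType) (w f g : R -> R) : R :=
  \int[@lebesgue_measure R]_(x in `[-1, 1]) (f x * g x * w x).

Definition is_jacobi_family (R : realType) (a b : R) (J : nat -> {poly R}) :=
  [/\ forall j, size (J j) = j.+1,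
      forall i j, i <> j ->
        weighted_dot (jacobi_weight a b) (horner (J i)) (horner (J j)) = 0
    & forall j, (J j).[1] = gbinomial (j%:R + a) j].

(** The polynomials characterised by [is_jacobi_family]. For [a, b > -1], the
    only case used, there is exactly one such family, so the default value
    given to [xget] is irrelevant. *)
Definition jacobi (R : realType) (a b : R) : nat -> {poly R} :=
  xget (fun=> 0) [set J | is_jacobi_family a b J].

(** The [i]th coefficient of the expansion of [f] in the orthogonal basis
    [jacobi a b]. *)
Definition jacobi_coef (R : realType) (a b : R) (f : R -> R) (i : nat) : R :=
  weighted_dot (jacobi_weight a b) f (horner (jacobi a b i)) /
  weighted_dot (jacobi_weight a b) (horner (jacobi a b i)) (horner (jacobi a b i)).

(** Infinitely differentiable on the closed interval: [g m] is the [m]th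
    derivative, which is one-sided at the endpoints. *)
Definition smooth_on_segment (R : realType) (f : R -> R) : Prop :=
  exists g : nat -> R -> R,
    (forall x, -1 <= x <= 1 -> g 0%N x = f x) /\
    (forall m x, -1 <= x <= 1 ->
       (g m y - g m x) / (y - x) @[y --> within `[-1, 1] x^'] --> g m.+1 x).

(** [L = a^N d^N/dx^N + ... + a^1 d/dx + a^0]. *)
Definition diff_op (R : realType) (N : nat) (a : nat -> R -> R) (u : R -> R)
    (x : R) : R :=
  \sum_(k < N.+1) a k x * derive1n k u x.

(** The [j]th member of the list [(f_0|f_1|...|f_(m-1)) C]. *)
Definition recombine (R : realType) (m n : nat) (f : nat -> {poly R})
    (C : 'M[R]_(m, n)) (j : 'I_n) : {poly R} :=
  \sum_(i < m) C i j *: f i.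

Definition imx (R : realType) := nat -> nat -> R.

Definition imx1 {R : realType} : imx R := fun i j => (i == j)%:R.

(** The entries are sums of series; for the products formed below all but
    finitely many terms of each series vanish. *)
Definition imx_mul {R : realType} (A B : imx R) : imx R :=
  fun i j => limn (fun p => \sum_(m < p) A i m * B m j).

(** [P A P^T] with [P = (I_m, 0)]. *)
Definition imx_trunc (R : realType) (m : nat) (A : imx R) : 'M[R]_m :=
  \matrix_(i < m, j < m) A i j.

Definition jacobi_D (R : realType) (a b : R) (k : nat) : imx R :=
  if k == 0%N then imx1 else
  fun i j => if j == (i + k)%N
    then 2 ^- k * (Gamma (a + b + (2 * k)%:R + i%:R + 1) /
                   Gamma (a + b + k%:R + i%:R + 1))
    else 0.

Definition jacobi_M (R : realType) (a b : R) (k : nat) (h : R -> R) : imx R :=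
  fun i j => jacobi_coef (a + k%:R) (b + k%:R)
    (fun x => h x * (jacobi (a + k%:R) (b + k%:R) j).[x]) i.

Definition jacobi_S (R : realType) (a b : R) (k : nat) : imx R :=
  fun i j => jacobi_coef (a + k.+1%:R) (b + k.+1%:R)
    (horner (jacobi (a + k%:R) (b + k%:R) j)) i.

(** [S_(N-1) ... S_k]. *)
Definition jacobi_Sprod (R : realType) (a b : R) (k N : nat) : imx R :=
  \big[imx_mul/imx1]_(m <- rev (index_iota k N)) jacobi_S a b m.

(** The infinite matrix
    [M_N[a^N] D_N + \sum_(k < N) S_(N-1) ... S_k M_k[a^k] D_k]. *)
Definition jacobi_L (R : realType) (a b : R) (N : nat) (c : nat -> R -> R) :
    imx R :=
  fun i j => imx_mul (jacobi_M a b N (c N)) (jacobi_D a b N) i j +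
    \sum_(k < N) imx_mul
      (imx_mul (jacobi_Sprod a b k N) (jacobi_M a b k (c k)))
      (jacobi_D a b k) i j.

Definition jacobi_d (R : realType) (a b : R) (N j : nat) : R :=
  (2 `^ (a + b + (2 * N)%:R + 1) * Gamma (j%:R + a + N%:R + 1)
     * Gamma (j%:R + b + N%:R + 1)) /
  (((2 * j)%:R + a + b + (2 * N)%:R + 1) * j`!%:R
     * Gamma (j%:R + a + b + (2 * N)%:R + 1)).

Definition jacobi_Omega (R : realType) (a b : R) (N m : nat) : 'M[R]_m :=
  diag_mx (\row_(j < m) jacobi_d a b N j).

Definition petrov_galerkin_mx (R : realType) (n : nat) (w : R -> R)
    (L : (R -> R) -> R -> R) (psi phi : 'I_n -> {poly R}) : 'M[R]_n :=
  \matrix_(i < n, j < n) weighted_dot w (horner (psi i)) (L (horner (phi j))).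

(* Main.v *)
Require Import Defs.
From HB Require Import structures.
From mathcomp Require Import all_boot all_order all_algebra.
From mathcomp Require Import all_classical all_reals all_analysis.
From mathcomp Require Import measurable_realfun zify ring lra.
From mathcomp Require polyorder.

Set Implicit Arguments.
Unset Strict Implicit.
Unset Printing Implicit Defensive.

Import Order.TTheory GRing.Theory Num.Theory.
Import numFieldNormedType.Exports.

Local Open Scope classical_set_scope.
Local Open Scope ring_scope.

(** Write (f, g)_k for the inner product with weight w^(alpha+k,beta+k). Since
    w^(alpha+k+1,beta+k+1) = (1 - x^2) w^(alpha+k,beta+k), and since
    (1 - x^2) J^(alpha+k+1,beta+k+1)_i is a polynomial of degree i + 2, the i-th
    Jacobi coefficient at level k + 1 of any continuous function is a finite
    combination, given by row i of S_k, of its coefficients at level k. Hence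
    each row of S_(N-1) ... S_k M_k[a^k] D_k consists of level N coefficients of
    the functions a^k (J_j)^(k), and the theorem reduces to linearity together
    with the values of the derivatives and norms of the Jacobi polynomials.

    The latter follow from Pearson's identity for the weight (integration by
    parts), which makes the Sturm-Liouville operator symmetric. On the basis
    (1 - x)^n this identity is a statement about the moments of the weight,
    i.e. about Beta integrals, which are computed with Tonelli's theorem from
    Gamma(p) Gamma(q) = Gamma(p + q) B(p, q); taking q = 1 this also yields the
    recursion of the Gamma function. *)

(** * Gamma and Beta integrals *)

Section affine.
Context {R : realType}.
Local Notation mu := (@lebesgue_measure R).
Local Open Scope ereal_scope.

(** Both measures, Lebesgue measure and [c] times its image under x -> c x + d, agree on half-open
    intervals, hence everywhere by uniqueness. Used for dilations (d = 0) and translations (c =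
    1). *)
Lemma ge0_integral_affine (c d : R) (f : R -> \bar R) : (0 < c)%R ->
  measurable_fun [set: R] f -> (forall x, 0 <= f x) ->
  \int[mu]_x f x = c%:E * \int[mu]_x f (c * x + d)%R.
Proof.
move=> c0 mf f0.
pose g : R -> measurableTypeR R := fun x : R => (c * x + d)%R.
have mg : measurable_fun [set: R] g.
  by apply: continuous_measurable_fun => x; apply: cvgD; [apply: cvgMl_tmp|exact: cvg_cst].
pose k : {nonneg R} := NngNum (ltW c0).
pose nu := measure_function_pushforward__canonical__measure_function_Measure mu mg.
transitivity (\int[mscale k nu]_x f x).
  apply: eq_measure_integral => A mA _; apply: lebesgue_measure_unique => //= _ [[a b]] _ <-.
  rewrite /mscale/= /pushforward lebesgue_measure_itv/=.
  have -> : g @^-1` `]a, b]%classic = `](a - d) / c, (b - d) / c]%classic%R.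
    apply/seteqP; split => x /=; rewrite /g !in_itv/= ltr_pdivrMr// ler_pdivlMr// mulrC;
      rewrite ltrBlDr lerBrDr //.
  rewrite lebesgue_measure_itv/= !lte_fin ltr_pM2r ?invr_gt0// ltrD2r.
  case: ifPn => ab; last by rewrite mule0.
  by rewrite -EFinM; congr EFin; field; rewrite gt_eqF.
rewrite ge0_integral_mscale//=; congr (_ * _).
by rewrite ge0_integral_pushforward.
Qed.

End affine.

Section power_kernel.
Context {R : realType}.
Local Notation mu := (@lebesgue_measure R).
Implicit Types p q s t u : R.

(** The extension by zero lets all Gamma and Beta integrals run over the whole line, where
    translations leave the domain unchanged. *)
Definition pkernel p t : R := if 0 < t then t `^ (p - 1) else 0.

(** Convolution of two kernels; its value at u = 1 is the Beta integral B(p, q). *)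
Definition pconv p q u : \bar R :=
  (\int[mu]_s (pkernel p s * pkernel q (u - s))%:E)%E.

(** Extended-real form of [Gamma], on which Tonelli's theorem can be applied before finiteness is
    known. *)
Definition eGamma p : \bar R := (\int[mu]_t (pkernel p t * expR (- t))%:E)%E.

Lemma pkernel_ge0 p t : 0 <= pkernel p t.
Proof. by rewrite /pkernel; case: ifP => // _; exact: powR_ge0. Qed.

Lemma pkernelM p c t : 0 < c -> pkernel p (c * t) = c `^ (p - 1) * pkernel p t.
Proof.
move=> c0; rewrite /pkernel pmulr_rgt0//; case: ifPn => [t0|_]; last by rewrite mulr0.
by rewrite powRM// ltW.
Qed.

Lemma measurable_pkernel p : measurable_fun [set: R] (pkernel p).
Proof.
by apply: measurable_fun_ifT;
  [exact: measurable_fun_ltr|exact: (@measurable_powR R (p - 1))|].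
Qed.

Lemma measurable_conv_integrand p q u :
  measurable_fun [set: R] (fun s : R => (pkernel p s * pkernel q (u - s))%:E).
Proof.
apply/measurable_EFinP/measurable_funM; first exact: measurable_pkernel.
apply: (measurableT_comp (measurable_pkernel q)); exact: measurable_funB.
Qed.

Lemma measurable_eGamma_integrand p :
  measurable_fun [set: R] (fun t : R => (pkernel p t * expR (- t))%:E).
Proof.
apply/measurable_EFinP/measurable_funM; first exact: measurable_pkernel.
by apply: measurableT_comp => //; exact: measurableT_comp.
Qed.

Lemma pconv_ge0 p q u : (0 <= pconv p q u)%E.
Proof. by apply: integral_ge0 => s _; rewrite lee_fin mulr_ge0// pkernel_ge0. Qed.

Lemma eGamma_ge0 p : (0 <= eGamma p)%E.
Proof. by apply: integral_ge0 => t _; rewrite lee_fin mulr_ge0 ?expR_ge0 ?pkernel_ge0. Qed.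

Lemma pconv_le0 p q u : u <= 0 -> pconv p q u = 0%E.
Proof.
move=> u0; apply: integral0_eq => s _; rewrite /pkernel.
case: ifPn => s0; last by rewrite mul0r.
by rewrite ifF ?mulr0//; apply/negbTE; rewrite -leNgt; lra.
Qed.

Lemma pconv_scale p q u : 0 < u ->
  pconv p q u = ((u `^ (p + q - 1))%:E * pconv p q 1)%E.
Proof.
move=> u0; have f0 s : (0 <= (pkernel p s * pkernel q (u - s))%:E)%E.
  by rewrite lee_fin mulr_ge0// pkernel_ge0.
transitivity (u%:E * \int[mu]_s
    (pkernel p (u * s + 0) * pkernel q (u - (u * s + 0)))%:E)%E.
  exact: (ge0_integral_affine 0 u0 (measurable_conv_integrand p q u) f0).
under eq_integral => s _.
  rewrite addr0 -{2}(mulr1 u) -mulrBr !pkernelM// mulrACA EFinM; over.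
rewrite ge0_integralZl//; first last.
- by rewrite lee_fin mulr_ge0// powR_ge0.
- by move=> s _; rewrite lee_fin mulr_ge0// pkernel_ge0.
- exact: measurable_conv_integrand.
rewrite muleA -EFinM; congr (_%:E * _)%E.
have pD r s : u `^ (r + s) = u `^ r * u `^ s.
  by apply: powRD; rewrite (gt_eqF u0) implybT.
(* One power of [u] comes from the change of variable, the others from the homogeneity of the two
   kernels. *)
rewrite -pD; have -> : p + q - 1 = 1 + (p - 1 + (q - 1)) by ring.
by rewrite [RHS]pD powRr1// ltW.
Qed.

(** Substitute t = u - s in the second factor and exchange the integrals: the inner one becomes the
    convolution at [u], and [pconv_scale] extracts the power u^(p+q-1). *)
Lemma eGammaM p q : (eGamma p * eGamma q = eGamma (p + q) * pconv p q 1)%E.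
Proof.
transitivity (\int[mu]_s \int[mu]_u
    (pkernel p s * pkernel q (u - s) * expR (- u))%:E)%E.
  rewrite {1}/eGamma -ge0_integralZr//; first last.
  - exact: eGamma_ge0.
  - by move=> s _; rewrite lee_fin mulr_ge0 ?expR_ge0 ?pkernel_ge0.
  - exact: measurable_eGamma_integrand.
  apply: eq_integral => s _.
  have g0 t : (0 <= (pkernel q t * expR (- t))%:E)%E.
    by rewrite lee_fin mulr_ge0 ?expR_ge0 ?pkernel_ge0.
  have -> : eGamma q = (1%:E * \int[mu]_u
      (pkernel q (1 * u + - s) * expR (- (1 * u + - s)))%:E)%E.
    exact: (ge0_integral_affine (- s) ltr01 (measurable_eGamma_integrand q) g0).
  rewrite mul1e -ge0_integralZl//; first last.
  - by rewrite lee_fin mulr_ge0 ?expR_ge0 ?pkernel_ge0.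
  - apply: (measurableT_comp (measurable_eGamma_integrand q)).
    by apply: measurable_funD => //; exact: measurable_funM.
  apply: eq_integral => u _; rewrite -EFinM mul1r; congr EFin.
  by rewrite mulrACA -expRD; congr (_ * expR _); ring.
pose f (z : R * R) := (pkernel p z.1 * pkernel q (z.2 - z.1) * expR (- z.2))%:E.
rewrite (@fubini_tonelli _ _ _ _ _ mu mu f); first last.
- by move=> z; rewrite lee_fin !mulr_ge0 ?expR_ge0 ?pkernel_ge0.
- apply/measurable_EFinP/measurable_funM; last first.
    apply: (measurableT_comp (@measurable_expR R)).
    by apply: measurableT_comp => //; exact: measurable_snd.
  apply: measurable_funM; first by apply: (measurableT_comp (measurable_pkernel p)).
  by apply: (measurableT_comp (measurable_pkernel q)); exact: measurable_funB.
rewrite /f /= -ge0_integralZr//; first last.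
- exact: pconv_ge0.
- by move=> s _; rewrite lee_fin mulr_ge0 ?expR_ge0 ?pkernel_ge0.
- exact: measurable_eGamma_integrand.
apply: eq_integral => u _.
under eq_integral do rewrite EFinM.
rewrite ge0_integralZr//; first last.
- by move=> s _; rewrite lee_fin mulr_ge0// pkernel_ge0.
- exact: measurable_conv_integrand.
rewrite -/(pconv p q u) {1}/pkernel; case: ifPn => [u0|]; last first.
  by rewrite -leNgt => u0; rewrite pconv_le0// mul0r !mul0e.
by rewrite pconv_scale// EFinM muleAC.
Qed.

End power_kernel.

Section gamma_function.
Context {R : realType}.
Local Notation mu := (@lebesgue_measure R).
Implicit Types p q s t u : R.

(** A zero integral forces [f] to vanish almost everywhere, so that ]a, b[ would be covered by a
    null set and the finite list [r]. The list makes room for the zeros of a polynomial. *)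
Lemma integral_gt0_itv (D : set R) (f : R -> R) (a b : R) (r : seq R) :
    measurable D -> measurable_fun D f -> (forall x, D x -> 0 <= f x) -> a < b ->
    (forall x, a < x < b -> x \notin r -> D x /\ 0 < f x) ->
  (0 < \int[mu]_(x in D) (f x)%:E)%E.
Proof.
move=> mD mf f0 ab Df; rewrite lt0e; apply/andP; split; last by apply: integral_ge0 => x /f0.
apply/eqP => If0.
have mEf : measurable_fun D (EFin \o f) by exact/measurable_EFinP.
have [+ _] := @ae_eq_integral_abs _ _ _ mu D mD (EFin \o f) mEf.
move=> -[|A [mA A0 NA]].
  by rewrite -[RHS]If0; apply: eq_integral => x /set_mem Dx /=; rewrite ger0_norm ?f0.
have cr : countable ([set` r] : set R) by exact/finite_set_countable/finite_seq.
have mr : measurable ([set` r] : set R) by exact: countable_measurable.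
have r0 : mu [set` r] = 0%E by exact: countable_lebesgue_measure0.
have : (mu `]a, b[ <= mu (A `|` [set` r]))%E.
  apply: le_measure; rewrite ?inE//; first exact: measurableU.
  move=> x /=; rewrite in_itv/= => xab.
  have [?|xr] := boolP (x \in r); [by right|left].
  have [Dx fx0] := Df _ xab xr.
  by apply: NA => /= /(_ Dx)[] fx; rewrite fx ltxx in fx0.
rewrite leNgt => /negP; apply.
apply: (@le_lt_trans _ _ 0%E).
  by apply: (le_trans (measureU2 _ mA mr)); rewrite [X in (X + _)%E]A0 [X in (_ + X)%E]r0 adde0.
by rewrite lebesgue_measure_itv/= lte_fin ab -EFinB lte_fin subr_gt0.
Qed.

Lemma eGammaE p :
  eGamma p = (\int[mu]_(t in `]0%R, +oo[) (t `^ (p - 1) * expR (- t))%:E)%E.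
Proof.
rewrite [RHS]integral_mkcond; apply: eq_integral => t _; rewrite patchE /pkernel.
by rewrite mem_setE in_itv/= andbT; case: ifPn => //; rewrite mul0r.
Qed.

Lemma Gamma_fine p : Gamma p = fine (eGamma p).
Proof. by rewrite eGammaE. Qed.

Lemma eGamma1 : eGamma 1 = 1%E :> \bar R.
Proof.
rewrite eGammaE; under eq_integral do rewrite subrr powRr0 mul1r.
have cE : continuous (fun t : R => expR (- t)).
  by move=> t; apply: continuous_comp; [exact: opp_continuous|exact: continuous_expR].
rewrite integral_itv_obnd_cbnd; last first.
  by apply/measurable_funTS/measurable_EFinP; exact: continuous_measurable_fun.
rewrite (@ge0_continuous_FTC2y _ _ (fun t => - expR (- t)) _ 0).
- by rewrite oppr0 expR0 -EFinB opprK add0r.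
- by move=> t _; exact: expR_ge0.
- exact: continuous_subspaceT.
- by rewrite -oppr0; apply: cvgN; exact: cvgr_expR.
- by move=> t _; exact: ex_derive.
- by apply: cvgN; apply: cvg_at_right_filter; exact: cE.
- by move=> t _; rewrite derive1E derive_val; rewrite /GRing.scale/=; ring.
Qed.

(** The integrand s^(p-1) may be singular at 0, so ]0, 1] is exhausted by the segments
    [e^-(n+1), 1]; the fundamental theorem applies on each and monotone convergence gives the
    limit. *)
Lemma pconv1 p : 0 < p -> pconv p 1 1 = (p^-1)%:E.
Proof.
move=> p0; pose f s : \bar R := (s `^ (p - 1))%:E.
have mf : measurable_fun setT f by apply/measurable_EFinP; exact: (@measurable_powR R (p - 1)).
pose F n : set R := `[expR (- n.+1%:R), 1]%classic.
have UF : \bigcup_n F n = `]0, 1]%classic.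
  apply/seteqP; split => [x [n _]|x]; rewrite /F/= !in_itv/=.
    by move=> /andP[nx x1]; rewrite x1 (lt_le_trans _ nx) ?expR_gt0.
  (* With this [n], n + 1 > - ln x, that is, e^-(n+1) < x. *)
  move=> /andP[x0 x1]; exists (Num.truncn (- ln x)) => //=; rewrite in_itv/= x1 andbT.
  rewrite -[leRHS](lnK x0) ler_expR lerNl ltW// truncnS_gt//.
have -> : pconv p 1 1 = (\int[mu]_(s in `]0%R, 1%R]) f s)%E.
  rewrite -integral_itv_bndo_bndc; last exact: measurable_funTS.
  rewrite [RHS]integral_mkcond; apply: eq_integral => s _; rewrite patchE /pkernel.
  rewrite mem_setE in_itv/= subrr powRr0 subr_gt0.
  by case: ltP => //= _; case: ifP; rewrite ?mulr1 ?mulr0 ?mul0r.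
rewrite -UF.
have IF n : (\int[mu]_(s in F n) f s)%E = (p^-1 * (1 - expR (- p) ^+ n.+1))%:E.
  rewrite (@continuous_FTC2 _ _ (fun s => p^-1 * s `^ p)).
  - rewrite -EFinB powR1 -mulrBr /powR gt_eqF ?expR_gt0// expRK; congr (_ * (_ - _))%:E.
    by rewrite -expRM_natl; congr expR; ring.
  - by rewrite -[ltRHS]expR0 ltr_expR oppr_lt0.
  - apply: continuous_in_subspaceT => s; rewrite inE/= in_itv/= => /andP[es _].
    apply: differentiable_continuous; apply/derivable1_diffP.
    by apply: derivable_powR; rewrite in_itv/= andbT (lt_le_trans _ es)// expR_gt0.
  - have cF s : 0 < s -> {for s, continuous (fun s => p^-1 * s `^ p)}.
      move=> s0; apply: differentiable_continuous; apply/derivable1_diffP.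
      by apply: derivableM => //; apply: derivable_powR; rewrite in_itv/= andbT.
    split; [|exact/cvg_at_right_filter/cF/expR_gt0|exact/cvg_at_left_filter/cF].
    move=> s; rewrite in_itv/= => /andP[es _]; apply: derivableM => //.
    by apply: derivable_powR; rewrite in_itv/= andbT (lt_trans _ es)// expR_gt0.
  - move=> s; rewrite in_itv/= => /andP[es _].
    have s0 : 0 < s by rewrite (lt_trans _ es)// expR_gt0.
    have dp := is_derive1_powR p s0.
    have -> : (fun s => p^-1 * s `^ p) = p^-1 \*: (@powR R ^~ p) :> (R -> R) by [].
    rewrite derive1E derive_val /GRing.scale/=.
    by rewrite mulrA mulVf ?gt_eqF// mul1r.
have cvI := @ge0_nondecreasing_set_cvg_integral _ (measurableTypeR R) R F f mu.
apply: (@cvg_unique _ _ (\int[mu]_(s in F n) f s @[n --> \oo])%E) => //.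
- apply: cvI => //.
  + move=> m n mn; apply/subsetPset => x; rewrite /F/= !in_itv/= => /andP[mx ->].
    by rewrite andbT (le_trans _ mx)// ler_expR lerN2 ler_nat.
  + by move=> i; exact: measurable_itv.
  + by move=> i; exact: measurable_funTS.
  + by move=> i x _; rewrite lee_fin powR_ge0.
- have -> : (fun n => \int[mu]_(s in F n) f s)%E =
      (fun n => (p^-1 * (1 - expR (- p) ^+ n.+1))%:E) by apply/funext; exact: IF.
  apply: cvg_EFin; first by near=> n.
  rewrite -[X in _ --> X]mulr1; apply: cvgMl_tmp.
  rewrite -[X in _ --> X]subr0; apply: cvgB; first exact: cvg_cst.
  rewrite (cvg_shiftS (fun n => expR (- p) ^+ n)).
  by apply: cvg_expr; rewrite ger0_norm ?expR_ge0// -expR0 ltr_expR oppr_lt0.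
Unshelve. all: by end_near. Qed.

(** The case q = 1 of [eGammaM], with Gamma(1) = 1 and B(p, 1) = 1/p. *)
Lemma eGamma_succ p : 0 < p -> eGamma (p + 1) = (p%:E * eGamma p)%E.
Proof.
move=> p0; have := eGammaM p 1; rewrite eGamma1 mule1 pconv1// => ->.
by rewrite muleCA -EFinM divff ?gt_eqF// mule1.
Qed.

Lemma eGamma_nat n : (eGamma n.+1%:R < +oo :> \bar R)%E.
Proof.
elim: n => [|n IH]; first by rewrite eGamma1 ltry.
by rewrite -natr1 eGamma_succ// lte_mul_pinfty// lee_fin.
Qed.

(** For t > 0 and p < n + 1, t^p <= 1 + t^(n+1), which bounds Gamma(p + 1) by values at integers;
    the recursion then brings finiteness back to [p]. *)
Lemma eGamma_lty p : 0 < p -> (eGamma p < +oo)%E.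
Proof.
move=> p0; have : (eGamma (p + 1) < +oo)%E.
  have [n pn] : exists n, p < n.+1%:R by exists (Num.truncn p); exact: truncnS_gt.
  apply: (@le_lt_trans _ _ (eGamma 1 + eGamma n.+2%:R)%E); last first.
    by apply: lte_add_pinfty; [exact: (eGamma_nat 0)|exact: (eGamma_nat n.+1)].
  rewrite /eGamma -ge0_integralD//; first last.
  - exact: measurable_eGamma_integrand.
  - by move=> t _; rewrite lee_fin mulr_ge0 ?expR_ge0 ?pkernel_ge0.
  - exact: measurable_eGamma_integrand.
  - by move=> t _; rewrite lee_fin mulr_ge0 ?expR_ge0 ?pkernel_ge0.
  apply: ge0_le_integral => //.
  - by move=> t _; rewrite lee_fin mulr_ge0 ?expR_ge0 ?pkernel_ge0.
  - exact: measurable_eGamma_integrand.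
  - by apply: emeasurable_funD; exact: measurable_eGamma_integrand.
  move=> t _; rewrite -EFinD lee_fin -mulrDl ler_wpM2r ?expR_ge0// /pkernel.
  case: ifPn => [t0|]; last by rewrite addr0.
  rewrite subrr powRr0 addrK; have [t1|t1] := leP t 1.
    rewrite (@le_trans _ _ 1) ?lerDl ?powR_ge0//.
    by rewrite -(powRr0 t) ger_powR ?t0// ltW.
  rewrite (@le_trans _ _ (t `^ (n.+2%:R - 1))) ?lerDr//.
  by apply: ler_powR; rewrite ltW// -natr1 addrK.
rewrite eGamma_succ//; have := eGamma_ge0 p.
by case: (eGamma p) => //= [r _ _|]; rewrite ?ltry// gt0_muley.
Qed.

Lemma EFin_Gamma p : 0 < p -> (Gamma p)%:E = eGamma p.
Proof. by move=> p0; rewrite Gamma_fine fineK// ge0_fin_numE ?eGamma_ge0 ?eGamma_lty. Qed.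

Lemma Gamma_gt0 p : 0 < p -> 0 < Gamma p.
Proof.
move=> p0; rewrite -lte_fin EFin_Gamma// eGammaE.
apply: (@integral_gt0_itv _ _ 0 1 [::]) => //.
- apply: measurable_funTS; apply: measurable_funM; first exact: (@measurable_powR R (p - 1)).
  by apply: measurableT_comp => //; exact: measurableT_comp.
- by move=> t _; rewrite mulr_ge0 ?expR_ge0 ?powR_ge0.
- by move=> t /andP[t0 _] _; rewrite /= in_itv/= t0 mulr_gt0 ?expR_gt0 ?powR_gt0.
Qed.

Lemma Gamma_succ p : 0 < p -> Gamma (p + 1) = p * Gamma p.
Proof.
move=> p0; apply: EFin_inj.
by rewrite EFinM !EFin_Gamma ?eGamma_succ// addr_gt0.
Qed.

Lemma pconv_Gamma p q : 0 < p -> 0 < q ->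
  pconv p q 1 = (Gamma p * Gamma q / Gamma (p + q))%:E.
Proof.
move=> p0 q0; have pq0 : 0 < p + q by rewrite addr_gt0.
rewrite !EFinM !EFin_Gamma// eGammaM -EFin_Gamma// muleAC -EFinM divff ?mul1e//.
by rewrite gt_eqF// Gamma_gt0.
Qed.

End gamma_function.

(** * Integration against a Jacobi weight *)

Section jacobi_functional.
Context {R : realType}.
Local Notation mu := (@lebesgue_measure R).
Implicit Types (a b : R) (p q : {poly R}) (f g : R -> R).

Lemma measurable_jacobi_weight a b : measurable_fun [set: R] (jacobi_weight a b).
Proof.
apply: measurable_funM.
- by apply: (measurableT_comp (@measurable_powR R a)); exact: measurable_funB.
- by apply: (measurableT_comp (@measurable_powR R b)); exact: measurable_funD.
Qed.

Lemma jacobi_weight_ge0 a b x : 0 <= jacobi_weight a b x.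
Proof. by rewrite mulr_ge0 ?powR_ge0. Qed.

Lemma jacobi_weight_gt0 a b x : -1 < x < 1 -> 0 < jacobi_weight a b x.
Proof. by move=> /andP[x1 x2]; rewrite mulr_gt0// powR_gt0; lra. Qed.

(** With s = x + 1 the factors 1 + x and 1 - x become s and 2 - s: the integral is the convolution
    of two power kernels at u = 2, a rescaled Beta integral. *)
Lemma integral_jacobi_weight a b : -1 < a -> -1 < b ->
  (\int[mu]_(x in `[(-1)%R, 1%R]) (jacobi_weight a b x)%:E)%E =
  (2 `^ (a + b + 1) * (Gamma (a + 1) * Gamma (b + 1) / Gamma (a + b + 2)))%:E.
Proof.
move=> a1 b1.
have a0 : 0 < a + 1 by lra.
have b0 : 0 < b + 1 by lra.
transitivity (pconv (b + 1) (a + 1) 2); last first.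
  rewrite (pconv_scale (b + 1) (a + 1) (@ltr0Sn R 1)) (pconv_Gamma b0 a0) -EFinM.
  rewrite [Gamma (b + 1) * Gamma (a + 1)]mulrC.
  have -> : b + 1 + (a + 1) = a + b + 2 by ring.
  by have -> : a + b + 2 - 1 = a + b + 1 by ring.
rewrite integral_itv_bndoo; last first.
  apply: measurable_funTS; apply/measurable_EFinP; exact: measurable_jacobi_weight.
have f0 s : (0 <= (pkernel (b + 1) s * pkernel (a + 1) (2 - s))%:E)%E.
  by rewrite lee_fin mulr_ge0// pkernel_ge0.
transitivity (1%:E * \int[mu]_s
    (pkernel (b + 1) (1 * s + 1) * pkernel (a + 1) (2 - (1 * s + 1)))%:E)%E; last first.
  apply/esym; apply: ge0_integral_affine ltr01 _ f0.
  exact: measurable_conv_integrand.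
rewrite mul1e integral_mkcond; apply: eq_integral => s _; rewrite patchE.
rewrite mem_setE in_itv/= /pkernel !addrK mul1r.
have -> : 2 - (s + 1) = 1 - s by ring.
rewrite subr_gt0 -ltrBlDr sub0r /jacobi_weight [s + 1]addrC mulrC.
by case: (-1 < s); case: (s < 1); rewrite /= ?mul0r ?mulr0.
Qed.

Lemma integrable_jacobi_weight a b : -1 < a -> -1 < b ->
  mu.-integrable `[(-1)%R, 1%R] (EFin \o jacobi_weight a b).
Proof.
move=> a1 b1; apply/integrableP; split.
  by apply: measurable_funTS; apply/measurable_EFinP; exact: measurable_jacobi_weight.
under eq_integral => x _ do rewrite /= ger0_norm ?jacobi_weight_ge0//.
by rewrite integral_jacobi_weight// ltry.
Qed.

Lemma within_continuous_measurable f :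
  {within `[-1, 1], continuous f} -> measurable_fun (`[-1, 1] : set R) f.
Proof. by move=> cf; apply: subspace_continuous_measurable_fun. Qed.

Lemma integrable_weighted a b f : -1 < a -> -1 < b ->
  {within `[-1, 1], continuous f} ->
  mu.-integrable `[(-1)%R, 1%R] (EFin \o (fun x => f x * jacobi_weight a b x)).
Proof.
move=> a1 b1 cf.
have -> : EFin \o (fun x => f x * jacobi_weight a b x) =
    ((EFin \o f) \* (EFin \o jacobi_weight a b))%E by [].
apply: integrableMr => //.
- exact: within_continuous_measurable.
- have /compact_bounded[M [_ mrt]] := continuous_compact cf (@segment_compact R (-1) 1).
  by exists M; split; rewrite ?num_real // => ? ? ? ?; exact: mrt.
- exact: integrable_jacobi_weight.
Qed.

Definition wint a b f : R := \int[mu]_(x in `[-1, 1]) (f x * jacobi_weight a b x).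

Lemma weighted_dotE a b f g :
  weighted_dot (jacobi_weight a b) f g = wint a b (fun x => f x * g x).
Proof. by []. Qed.

Lemma eq_wint a b f g : (forall x, -1 <= x <= 1 -> f x = g x) ->
  wint a b f = wint a b g.
Proof.
move=> fg; apply: eq_Rintegral => x; rewrite inE/= in_itv/= => x11.
by rewrite fg.
Qed.

Lemma within_horner p (A : set R) : {within A, continuous (horner p)}.
Proof. by apply: continuous_subspaceT; exact: continuous_horner. Qed.

Lemma within_continuousM f g (A : set R) : {within A, continuous f} ->
  {within A, continuous g} -> {within A, continuous (fun x => f x * g x)}.
Proof. by move=> cf cg x; apply: cvgM; [exact: cf|exact: cg]. Qed.

Lemma within_continuousD f g (A : set R) : {within A, continuous f} ->
  {within A, continuous g} -> {within A, continuous (fun x => f x + g x)}.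
Proof. by move=> cf cg x; apply: cvgD; [exact: cf|exact: cg]. Qed.

Lemma within_cst (c : R) (A : set R) : {within A, continuous (fun _ : R => c)}.
Proof. by move=> x; exact: cvg_cst. Qed.

Lemma within_sum (I : Type) (r : seq I) (F : I -> R -> R) (A : set R) :
  (forall i, {within A, continuous (F i)}) ->
  {within A, continuous (fun x => \sum_(i <- r) F i x)}.
Proof.
move=> cF; elim: r => [|i r IH].
  by under eq_fun do rewrite big_nil; exact: within_cst.
by under eq_fun do rewrite big_cons; exact: within_continuousD.
Qed.

Section wint_linear.
Variables (a b : R).
Hypotheses (a1 : -1 < a) (b1 : -1 < b).

Lemma wintD f g : {within `[-1, 1], continuous f} -> {within `[-1, 1], continuous g} ->
  wint a b (fun x => f x + g x) = wint a b f + wint a b g.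
Proof.
move=> cf cg; rewrite /wint -RintegralD//; [|exact: integrable_weighted..].
by apply: eq_Rintegral => x _; rewrite mulrDl.
Qed.

Lemma wintZ c f : {within `[-1, 1], continuous f} ->
  wint a b (fun x => c * f x) = c * wint a b f.
Proof.
move=> cf; rewrite /wint -RintegralZl//; last exact: integrable_weighted.
by apply: eq_Rintegral => x _; rewrite mulrA.
Qed.

Lemma wint0 : wint a b (fun=> 0) = 0.
Proof. by have := wintZ 0 (@within_cst 0 `[-1, 1]); rewrite !mul0r. Qed.

Lemma wint_sum (I : Type) (r : seq I) (F : I -> R -> R) :
  (forall i, {within `[-1, 1], continuous (F i)}) ->
  wint a b (fun x => \sum_(i <- r) F i x) = \sum_(i <- r) wint a b (F i).
Proof.
move=> cF; elim: r => [|i r IH].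
  by under [LHS]eq_wint do rewrite big_nil; rewrite wint0 big_nil.
under eq_wint do rewrite big_cons; rewrite wintD ?IH ?big_cons//.
exact: within_sum.
Qed.

End wint_linear.

(** The pointwise identity (1-x)^(a+1) = (1-x) (1-x)^a also holds at x = 1, because a + 1 > 0. *)
Lemma wint_shiftl a b f : -1 < a ->
  wint (a + 1) b f = wint a b (fun x => f x * (1 - x)).
Proof.
move=> a1; apply: eq_Rintegral => x; rewrite inE/= in_itv/= => /andP[x1 x2].
rewrite /jacobi_weight -[in LHS]mulr_powRB1 ?addrK; [ring|lra|lra].
Qed.

Lemma wint_shiftr a b f : -1 < b ->
  wint a (b + 1) f = wint a b (fun x => f x * (1 + x)).
Proof.
move=> b1; apply: eq_Rintegral => x; rewrite inE/= in_itv/= => /andP[x1 x2].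
rewrite /jacobi_weight -[in LHS](@mulr_powRB1 _ (1 + x)) ?addrK; [ring|lra|lra].
Qed.

Lemma wint1 a b : -1 < a -> -1 < b -> wint a b (fun=> 1) =
  2 `^ (a + b + 1) * (Gamma (a + 1) * Gamma (b + 1) / Gamma (a + b + 2)).
Proof.
move=> a1 b1; apply: EFin_inj; rewrite -integral_jacobi_weight//.
rewrite /wint /Rintegral; under eq_integral do rewrite mul1r.
by rewrite fineK// integral_jacobi_weight.
Qed.

(** Supplies the exceptional list of [integral_gt0_itv], and thereby the definiteness of the inner
    product on polynomials. *)
Lemma finite_roots p : p != 0 -> exists r : seq R, forall x, root p x -> x \in r.
Proof.
have [n] := ubnP (size p); elim: n p => // n IH p pn p0.
have [[c rc]|nr] := pselect (exists c, root p c); last first.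
  by exists [::] => x rx; case: nr; exists x.
have /factor_theorem[q pq] := rc.
have q0 : q != 0 by apply: contra_neq p0 => q0; rewrite pq q0 mul0r.
have [|r rq] := IH q _ q0.
  by move: pn; rewrite pq size_Mmonic ?monicXsubC// size_XsubC addn2.
exists (c :: r) => x; rewrite pq rootM root_XsubC inE => /orP[/rq ->|->//].
by rewrite orbT.
Qed.

Lemma wint_gt0 a b p : -1 < a -> -1 < b -> p != 0 -> 0 < wint a b (horner (p ^+ 2)).
Proof.
move=> a1 b1 p0.
have iw := integrable_weighted a1 b1 (@within_horner (p ^+ 2) `[-1, 1]).
rewrite /wint /Rintegral fine_gt0//; apply/andP; split; last first.
  by rewrite ltey_eq; apply/orP; left; exact: integrable_fin_num.
have [r rp] : exists r : seq R, forall x, root p x -> x \in r.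
  exact: finite_roots.
apply: (@integral_gt0_itv _ _ _ (-1) 1 r) => //.
- apply: measurable_funTS; apply: measurable_funM; last exact: measurable_jacobi_weight.
  by apply: continuous_measurable_fun; exact: continuous_horner.
- by move=> x _; rewrite horner_exp mulr_ge0 ?sqr_ge0 ?jacobi_weight_ge0.
move=> x x11 xr; split; first by rewrite /= in_itv/= !ltW//; case/andP: x11.
rewrite mulr_gt0 ?jacobi_weight_gt0// horner_exp exprn_even_gt0//=.
by apply: contra xr => /rp.
Qed.

(** On polynomials the functional is linear without continuity side conditions. *)
Definition jint a b p : R := wint a b (horner p).

Lemma jintE a b p q : weighted_dot (jacobi_weight a b) (horner p) (horner q) = jint a b (p * q).
Proof. by apply: eq_wint => x _; rewrite hornerM. Qed.

Lemma jint_shiftl a b p : -1 < a -> jint (a + 1) b p = jint a b ((1 - 'X) * p).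
Proof.
move=> a1; rewrite /jint wint_shiftl//; apply: eq_wint => x _.
by rewrite !hornerE mulrC.
Qed.

Lemma jint_shiftr a b p : -1 < b -> jint a (b + 1) p = jint a b ((1 + 'X) * p).
Proof.
move=> a1; rewrite /jint wint_shiftr//; apply: eq_wint => x _.
by rewrite !hornerE mulrC.
Qed.

Lemma jint_shift a b p : -1 < a -> -1 < b ->
  jint (a + 1) (b + 1) p = jint a b ((1 - 'X^2) * p).
Proof.
move=> a1 b1; rewrite jint_shiftl ?jint_shiftr// mulrA.
by have -> : (1 + 'X) * (1 - 'X) = 1 - 'X^2 :> {poly R} by ring.
Qed.

Lemma jint1 a b : -1 < a -> -1 < b -> jint a b 1 =
  2 `^ (a + b + 1) * (Gamma (a + 1) * Gamma (b + 1) / Gamma (a + b + 2)).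
Proof.
by move=> a1 b1; rewrite -wint1//; apply: eq_wint => x _; rewrite hornerC.
Qed.

Lemma jint_gt0 a b p : -1 < a -> -1 < b -> p != 0 -> 0 < jint a b (p * p).
Proof. by move=> *; rewrite -expr2; exact: wint_gt0. Qed.

Section jint_linear.
Variables (a b : R).
Hypotheses (a1 : -1 < a) (b1 : -1 < b).

Lemma jintD p q : jint a b (p + q) = jint a b p + jint a b q.
Proof.
rewrite /jint -wintD//; [|exact: within_horner..].
by apply: eq_wint => x _; rewrite hornerD.
Qed.

Lemma jintZ c p : jint a b (c *: p) = c * jint a b p.
Proof.
rewrite /jint -wintZ//; last exact: within_horner.
by apply: eq_wint => x _; rewrite hornerZ.
Qed.

Lemma jint0 : jint a b 0 = 0.
Proof. by rewrite -(scale0r 0) jintZ mul0r. Qed.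

Lemma jintN p : jint a b (- p) = - jint a b p.
Proof. by rewrite -scaleN1r jintZ mulN1r. Qed.

Lemma jintB p q : jint a b (p - q) = jint a b p - jint a b q.
Proof. by rewrite jintD jintN. Qed.

Lemma jint_sum (I : Type) (r : seq I) (P : pred I) (F : I -> {poly R}) :
  jint a b (\sum_(i <- r | P i) F i) = \sum_(i <- r | P i) jint a b (F i).
Proof. exact: (big_morph (jint a b) jintD jint0). Qed.

End jint_linear.

Lemma jint_shiftn a b n p : -1 < a ->
  jint (a + n%:R) b p = jint a b ((1 - 'X) ^+ n * p).
Proof.
move=> a1; elim: n p => [|n IH] p; first by rewrite addr0 expr0 mul1r.
rewrite -natr1 addrA jint_shiftl; last by rewrite ltr_wpDr.
by rewrite IH mulrA -exprSr.
Qed.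

Definition pearson a b p : {poly R} :=
  (1 - 'X^2) * p^`() + ((b + 1) *: (1 - 'X) - (a + 1) *: (1 + 'X)) * p.

(* [pearson a b p] times the weight is the derivative of
   [p (1-x)^(a+1) (1+x)^(b+1)]. On the basis [(1-x)^n] the identity reduces,
   by shifting [a], to the case [p = 1], i.e. to the recursion of the Gamma
   function. *)
Lemma jint_pearson a b p : -1 < a -> -1 < b -> jint a b (pearson a b p) = 0.
Proof.
move=> a1 b1.
have pearson1 c : -1 < c -> jint c b ((b + 1) *: (1 - 'X) - (c + 1) *: (1 + 'X)) = 0.
  move=> c1; rewrite jintB// !jintZ//.
  rewrite -[1 - 'X]mulr1 -[1 + 'X]mulr1 -jint_shiftl// -jint_shiftr// !jint1//; [|lra..].
  have c0 : 0 < c + 1 by lra.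
  have b0 : 0 < b + 1 by lra.
  have -> : c + 1 + b + 1 = c + b + 1 + 1 by ring.
  have -> : c + (b + 1) + 1 = c + b + 1 + 1 by ring.
  have -> : c + 1 + b + 2 = c + (b + 1) + 2 by ring.
  rewrite (Gamma_succ c0) (Gamma_succ b0).
  move: (Gamma (c + 1)) (Gamma (b + 1)) (Gamma _) (2 `^ _) => *; ring.
have pearsonD : {morph pearson a b : p q / p + q}.
  by move=> q r; rewrite /pearson derivD -!mul_polyC; ring.
have pearsonZ c q : pearson a b (c *: q) = c *: pearson a b q.
  by rewrite /pearson derivZ -!mul_polyC; ring.
(* Differentiating (1-x)^n contributes -n (1+x) (1-x)^n, which turns a + 1 into a + n + 1; the power
   (1-x)^n is then absorbed into the weight. *)
have pearsonX n : jint a b (pearson a b ((1 - 'X) ^+ n)) = 0.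
  have an1 : -1 < a + n%:R by rewrite ltr_wpDr.
  rewrite -[RHS](pearson1 _ an1) jint_shiftn//; congr jint.
  rewrite /pearson; case: n {an1} => [|n].
    by rewrite !expr0 derivC mulr0 add0r mulr1 mul1r addr0.
  rewrite deriv_exp derivB derivC derivX/= -natr1 -!mul_polyC !polyCD -mulr_natr.
  by rewrite polyC_natr -natr1 polyC1 (exprS _ n); ring.
(* The substitution x -> 1 - x is an involution, so the powers of 1 - x span all polynomials. *)
have [q ->] : exists q, p = q \Po (1 - 'X).
  exists (p \Po (1 - 'X)); rewrite -comp_polyA comp_polyB comp_polyC comp_polyX.
  by rewrite opprB addrC subrK comp_polyXr.
rewrite comp_polyE; elim/big_ind: _ => [|r s|i _].
- by have := pearsonZ 0 0; rewrite !scale0r => ->; rewrite jint0.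
- by move=> r0 s0; rewrite pearsonD jintD// r0 s0 addr0.
- by rewrite pearsonZ jintZ// pearsonX mulr0.
Qed.

End jacobi_functional.

(** * Jacobi polynomials *)

Section jacobi_polynomials.
Context {R : realType}.
Implicit Types (a b : R) (p q : {poly R}) (J : nat -> {poly R}).

Lemma graded_expand J : (forall j, size (J j) = j.+1) ->
  forall n q, (size q <= n)%N -> exists c : nat -> R, q = \sum_(j < n) c j *: J j.
Proof.
move=> sJ; elim=> [|n IH] q sq.
  by exists (fun=> 0); move: sq; rewrite big_ord0 leqn0 size_poly_eq0 => /eqP.
have Jn0 : (J n)`_n != 0.
  by have := sJ n; rewrite -[X in _`_X]/(n.+1.-1) => <-; rewrite lead_coef_eq0 -size_poly_eq0 sJ.
have [|c qc] := IH (q - (q`_n / (J n)`_n) *: J n).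
  apply/leq_sizeP => i; rewrite leq_eqVlt coefB coefZ => /predU1P[<-|ni].
    by rewrite divfK ?subrr.
  have Ji0 : (J n)`_i = 0 by rewrite nth_default ?sJ.
  by rewrite (nth_default _ (leq_trans sq ni)) Ji0 mulr0 subr0.
exists (fun j => if j == n then q`_n / (J n)`_n else c j).
rewrite big_ord_recr/= eqxx -[LHS](subrK ((q`_n / (J n)`_n) *: J n)) qc; congr (_ + _).
by apply: eq_bigr => i _; rewrite ltn_eqF.
Qed.

Section fixed_weight.
Variables (a b : R).
Hypotheses (a1 : -1 < a) (b1 : -1 < b).

Definition orth_below n p := forall q, (size q <= n)%N -> jint a b (p * q) = 0.

Lemma orth_below_graded n p J : (forall j, size (J j) = j.+1) ->
  (forall j, (j < n)%N -> jint a b (p * J j) = 0) -> orth_below n p.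
Proof.
move=> sJ pJ q /(graded_expand sJ)[c ->].
rewrite mulr_sumr jint_sum// big1// => j _.
by rewrite -scalerAr jintZ// pJ ?mulr0.
Qed.

Lemma jint_eq0 p : jint a b (p * p) = 0 -> p = 0.
Proof.
by move=> pp0; apply/eqP/negPn/negP => /(jint_gt0 a1 b1); rewrite pp0 ltxx.
Qed.

(** Subtracting the multiple of [q] that cancels the coefficient of degree [n] leaves a polynomial
    of degree below [n] that is orthogonal to itself. *)
Lemma orth_below_collinear n p q : size q = n.+1 -> orth_below n q ->
  (size p <= n.+1)%N -> orth_below n p -> p = (p`_n / q`_n) *: q.
Proof.
move=> sq oq sp op.
have qn0 : q`_n != 0.
  by rewrite -[n]/(n.+1.-1) -sq; rewrite lead_coef_eq0 -size_poly_eq0 sq.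
set c := _ / _; set r := p - c *: q.
have sr : (size r <= n)%N.
  apply/leq_sizeP => i; rewrite leq_eqVlt coefB coefZ => /predU1P[<-|ni].
    by rewrite divfK ?subrr.
  have qi0 : q`_i = 0 by rewrite nth_default ?sq.
  by rewrite (nth_default _ (leq_trans sp ni)) qi0 mulr0 subr0.
apply/eqP; rewrite -subr_eq0; apply/eqP/jint_eq0.
by rewrite -/r {1}/r mulrBl jintB// -scalerAl jintZ// op// oq// mulr0 subr0.
Qed.

(** If p = q (X - 1), orthogonality of [p] to [q] makes the integral of (1 - x) q^2 vanish, although
    it is a squared norm for the weight with [a + 1]. This permits the normalization at 1. *)
Lemma orth_below_at1 n p : size p = n.+1 -> orth_below n p -> p.[1] != 0.
Proof.
move=> sp op; apply/negP => /factor_theorem[q pq].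
have q0 : q != 0.
  by apply/eqP => q0; move: sp; rewrite pq q0 mul0r size_poly0.
have sq : (size q <= n)%N.
  by move: sp; rewrite pq size_Mmonic ?monicXsubC// size_XsubC addn2/= => -[->].
have a1' : -1 < a + 1 by rewrite ltr_wpDr.
have := jint_gt0 a1' b1 q0; rewrite jint_shiftl//.
have -> : (1 - 'X) * (q * q) = - (p * q) by rewrite pq polyC1; ring.
by rewrite jintN// op// oppr0 ltxx.
Qed.

Lemma orth_exists n : exists p, size p = n.+1 /\ orth_below n p.
Proof.
elim/ltn_ind: n => n IH.
(* Gram-Schmidt: monomials fill the indices from [n] on, so that [J] is a graded family on all of
   nat. *)
have /choice[J HJ] : forall i, exists p, size p = i.+1 /\ ((i < n)%N -> orth_below i p).
  move=> i.
  have [/IH[p [sp op]]|ni] := ltnP i n; first by exists p.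
  by exists 'X^i; rewrite size_polyXn.
have sJ i : size (J i) = i.+1 by case: (HJ i).
have oJ i : (i < n)%N -> orth_below i (J i) by case: (HJ i).
pose c i := jint a b ('X^n * J i) / jint a b (J i * J i).
exists ('X^n - \sum_(i < n) c i *: J i); split.
  rewrite size_polyDl size_polyXn// size_polyN ltnS.
  apply: (leq_trans (size_sum _ _ _)); apply/bigmax_leqP => i _.
  by rewrite (leq_trans (size_scale_leq _ _))// sJ.
apply: (orth_below_graded sJ) => j jn.
rewrite mulrBl jintB// mulr_suml jint_sum// (bigD1 (Ordinal jn))//= big1 ?addr0.
  rewrite -scalerAl jintZ// divfK ?subrr//.
  by rewrite gt_eqF// jint_gt0// -size_poly_eq0 sJ.
move=> i; rewrite -val_eqE/= neq_ltn => /orP[ij|ji].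
  by rewrite -scalerAl jintZ// mulrC (mulrC (J i)) oJ ?mul0r ?sJ.
by rewrite -scalerAl jintZ// oJ ?mulr0 ?sJ.
Qed.

Lemma gbinomial_gt0 j : 0 < gbinomial (j%:R + a) j.
Proof.
rewrite divr_gt0 ?ltr0n ?fact_gt0// prodr_gt0// => i _.
have ij : i%:R + 1 <= j%:R :> R by rewrite natr1 ler_nat.
by move: ij a1; lra.
Qed.

(** Existence of a family, obtained by rescaling the orthogonal polynomials to the prescribed values
    at 1, excludes the default of [xget]. *)
Lemma jacobi_family : is_jacobi_family a b (jacobi a b).
Proof.
have [J HJ] := choice orth_exists.
apply: (@xgetPex _ _ [set J | is_jacobi_family a b J]).
exists (fun j => (gbinomial (j%:R + a) j / (J j).[1]) *: J j).
have J1 j : (J j).[1] != 0 by have [? ?] := HJ j; exact: (@orth_below_at1 j).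
split=> [j|i j ij|j].
- rewrite size_scale; first by case: (HJ j).
  by rewrite mulf_neq0 ?invr_eq0// gt_eqF// gbinomial_gt0.
- rewrite jintE -scalerAl jintZ// -scalerAr jintZ//.
  suff -> : jint a b (J i * J j) = 0 by rewrite !mulr0.
  have [ij'|ji|//] := ltngtP i j.
    by rewrite mulrC; have [_ ->] := HJ j => //; have [->] := HJ i.
  by have [_ ->] := HJ i => //; have [->] := HJ j.
- by rewrite hornerZ divfK.
Qed.

Lemma size_jacobi j : size (jacobi a b j) = j.+1.
Proof. by have [] := jacobi_family. Qed.

Lemma jacobi_neq0 j : jacobi a b j != 0.
Proof. by rewrite -size_poly_eq0 size_jacobi. Qed.

Lemma jacobi_at1 j : (jacobi a b j).[1] = gbinomial (j%:R + a) j.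
Proof. by have [] := jacobi_family. Qed.

Lemma jacobi_orth i j : i <> j -> jint a b (jacobi a b i * jacobi a b j) = 0.
Proof. by move=> ij; rewrite -jintE; have [_ ->] := jacobi_family. Qed.

Lemma jacobi_orth_below n : orth_below n (jacobi a b n).
Proof.
apply: (orth_below_graded size_jacobi) => j jn; apply: jacobi_orth => nj.
by rewrite nj ltnn in jn.
Qed.

Lemma jacobi_norm_gt0 n : 0 < jint a b (jacobi a b n * jacobi a b n).
Proof. by rewrite jint_gt0// jacobi_neq0. Qed.

(** Recognizes a multiple of a Jacobi polynomial from degree and orthogonality; the value at 1 fixes
    the factor. *)
Lemma jacobi_collinear n p : (size p <= n.+1)%N -> orth_below n p ->
  p = (p.[1] / gbinomial (n%:R + a) n) *: jacobi a b n.
Proof.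
move=> sp op.
have e := orth_below_collinear (size_jacobi n) (@jacobi_orth_below n) sp op.
rewrite [LHS]e; congr (_ *: _); rewrite [X in X.[1]]e hornerZ jacobi_at1 mulfK//.
by rewrite gt_eqF// gbinomial_gt0.
Qed.

(** The Jacobi differential operator (1 - x^2) D^2 + (b - a - (a + b + 2) x) D. *)
Definition sturm p : {poly R} := pearson a b p^`().

(** Pearson's identity for the product of [q] with the derivative of [p], that is, integration by
    parts. *)
Lemma jint_sturm p q :
  jint a b (sturm p * q) = - jint a b ((1 - 'X^2) * p^`() * q^`()).
Proof.
apply/eqP; rewrite -subr_eq0 opprK -jintD// -(jint_pearson (p^`() * q) a1 b1).
by apply/eqP; congr (jint _ _ _); rewrite /sturm /pearson derivM -!mul_polyC; ring.
Qed.

Lemma jint_sturmC p q : jint a b (sturm p * q) = jint a b (p * sturm q).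
Proof. by rewrite (mulrC p) !jint_sturm mulrAC. Qed.

(** On monomials the operator is upper triangular, with diagonal entries -i (i + a + b + 1), the
    future eigenvalues. *)
Lemma coef_sturm p i : (sturm p)`_i =
  p`_i.+2 * (i.+2 * i.+1)%:R + (b - a) * (p`_i.+1 * i.+1%:R)
  - i%:R * (i%:R + a + b + 1) * p`_i.
Proof.
have -> : sturm p = p^`()^`() - 'X^2 * p^`()^`() + (b - a) *: p^`()
    - (a + b + 2) *: ('X * p^`()).
  rewrite /sturm /pearson -!mul_polyC !polyCD !polyCN !polyC1; ring.
have cd q k : (q^`())`_k = q`_k.+1 * k.+1%:R by rewrite coef_deriv mulr_natr.
rewrite !(coefB, coefD, coefN, coefZ, coefXM, coefXnM, cd) natrM.
by case: i => [|[|i]] /=; rewrite ?subn2/= -?natr1; ring.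
Qed.

Lemma size_sturm n p : (size p <= n)%N -> (size (sturm p) <= n)%N.
Proof.
move=> sp; apply/leq_sizeP => i ni; rewrite coef_sturm.
have p0 k : p`_(k + i) = 0.
  by rewrite nth_default// (leq_trans sp)// (leq_trans ni)// leq_addl.
by rewrite (p0 2%N) (p0 1%N) (p0 0%N) !(mul0r, mulr0) subr0 addr0.
Qed.

(** The operator does not raise degrees and is symmetric, so the image of J_n has degree at most n
    and is again orthogonal to all lower degrees; comparing coefficients of degree n gives the
    eigenvalue. *)
Lemma sturm_jacobi n :
  sturm (jacobi a b n) = (- (n%:R * (n%:R + a + b + 1))) *: jacobi a b n.
Proof.
have sJ := size_jacobi n.
rewrite [LHS](@orth_below_collinear n _ (jacobi a b n)) ?size_sturm ?sJ//.
- congr (_ *: _); rewrite coef_sturm.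
  have J0 k : (n < k)%N -> (jacobi a b n)`_k = 0 by move=> nk; rewrite nth_default ?sJ.
  have Jn : (jacobi a b n)`_n != 0.
    by rewrite -[X in _`_X]/(n.+1.-1) -sJ lead_coef_eq0 jacobi_neq0.
  by rewrite (J0 n.+1)// (J0 n.+2)// !(mul0r, mulr0) !add0r -mulNr mulfK.
- exact: jacobi_orth_below.
- move=> q sq; rewrite jint_sturmC; apply: jacobi_orth_below; exact: size_sturm.
Qed.

(** The eigenvalue equation evaluated at x = 1, where the second-order term vanishes. *)
Lemma jacobi_deriv_at1 n :
  ((jacobi a b n)^`()).[1] * (2 * (a + 1)) =
  n%:R * (n%:R + a + b + 1) * gbinomial (n%:R + a) n.
Proof.
have e : (sturm (jacobi a b n)).[1] = - (2 * (a + 1) * ((jacobi a b n)^`()).[1]).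
  rewrite /sturm /pearson !hornerE expr1n; ring.
by rewrite mulrC; apply: oppr_inj; rewrite -e sturm_jacobi hornerZ jacobi_at1 mulNr.
Qed.

(** The factor 1 - x^2 in the symmetric form of the operator is the ratio of the two weights. Hence
    the derivatives are orthogonal for the shifted weight, with known norms. *)
Lemma jint_deriv_jacobi m n :
  jint (a + 1) (b + 1) ((jacobi a b m)^`() * (jacobi a b n)^`()) =
  n%:R * (n%:R + a + b + 1) * jint a b (jacobi a b m * jacobi a b n).
Proof.
rewrite jint_shift// mulrA -[LHS]opprK -jint_sturm jint_sturmC sturm_jacobi.
by rewrite -scalerAr jintZ// mulNr opprK.
Qed.

End fixed_weight.

Lemma gbinomialSS a n :
  gbinomial (n.+1%:R + a) n.+1 = (a + 1) / n.+1%:R * gbinomial (n%:R + (a + 1)) n.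
Proof.
have -> : n%:R + (a + 1) = n.+1%:R + a by rewrite -natr1; ring.
rewrite /gbinomial big_ord_recr/= factS natrM.
have nS : n.+1%:R != 0 :> R by rewrite pnatr_eq0.
have nf : n`!%:R != 0 :> R by rewrite pnatr_eq0 -lt0n fact_gt0.
rewrite -natr1; move: (\prod_(i < n) _) => P; field.
by rewrite nf natr1.
Qed.

(** The derivatives of J_1, J_2, ... form a graded family orthogonal for the shifted weight, so each
    is a multiple of the shifted Jacobi polynomial; values at 1 give the factor. *)
Lemma deriv_jacobi a b n : -1 < a -> -1 < b -> (jacobi a b n.+1)^`() =
  ((n%:R + a + b + 2) / 2) *: jacobi (a + 1) (b + 1) n.
Proof.
move=> a1 b1; have a1' : -1 < a + 1 by lra.
have b1' : -1 < b + 1 by lra.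
have sJ' j : size ((jacobi a b j.+1)^`()) = j.+1.
  by rewrite polyorder.size_deriv size_jacobi.
rewrite [LHS](@jacobi_collinear (a + 1) (b + 1) _ _ n)//.
- congr (_ *: _).
  have g0 := gbinomial_gt0 a1' n.
  have := jacobi_deriv_at1 a1 b1 n.+1; rewrite gbinomialSS.
  have nS : n.+1%:R != 0 :> R by rewrite pnatr_eq0.
  set d := (_^`()).[1]; set g := gbinomial _ _ in g0 *.
  have gn0 : g != 0 by rewrite gt_eqF.
  have a0 : 2 * (a + 1) != 0 by rewrite mulf_neq0 ?pnatr_eq0// gt_eqF//; lra.
  move=> e; apply: (mulIf gn0); rewrite divfK//; apply: (mulIf a0).
  rewrite e -natr1; field; by rewrite natr1.
- by rewrite sJ'.
- apply: (orth_below_graded _ _ sJ') => // j jn.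
  rewrite jint_deriv_jacobi// jacobi_orth ?mulr0// => -[nj].
  by rewrite nj ltnn in jn.
Qed.

(** Equates two values of the squared norm of the derivative: one from [jint_deriv_jacobi], one from
    [deriv_jacobi]. *)
Lemma jacobi_norm_succ a b n : -1 < a -> -1 < b ->
  jint a b (jacobi a b n.+1 * jacobi a b n.+1) =
  (n%:R + a + b + 2) / (4 * n.+1%:R) *
  jint (a + 1) (b + 1) (jacobi (a + 1) (b + 1) n * jacobi (a + 1) (b + 1) n).
Proof.
move=> a1 b1; have := jint_deriv_jacobi a1 b1 n.+1 n.+1.
have a1' : -1 < a + 1 by lra.
have b1' : -1 < b + 1 by lra.
rewrite (deriv_jacobi _ a1 b1) -scalerAl -scalerAr !(jintZ a1' b1').
set h := jint a b _; set h' := jint _ _ _ => e.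
have s0 : n%:R + a + b + 2 != 0.
  have n0 : 0 <= n%:R :> R := ler0n _ _.
  by rewrite gt_eqF//; lra.
have nS : n.+1%:R != 0 :> R by rewrite pnatr_eq0.
apply: (mulfI s0); apply: (mulfI nS).
transitivity (n.+1%:R * (n.+1%:R + a + b + 1) * h); first by rewrite -natr1; ring.
by rewrite -e; field.
Qed.

Lemma jacobi_zero a b : -1 < a -> -1 < b -> jacobi a b 0 = 1.
Proof.
move=> a1 b1; have sJ := size_jacobi a1 b1 0.
have [c Jc] : exists c, jacobi a b 0 = c%:P by eexists; apply: size1_polyC; rewrite sJ.
have := jacobi_at1 a1 b1 0; rewrite Jc hornerC => ->.
by rewrite /gbinomial big_ord0 fact0 divr1.
Qed.

(** Induction on the degree with [a] and [b] general, since each step raises both by 1. In degree 0,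
    a + b + 1 > 0 allows Gamma(a+b+2) = (a+b+1) Gamma(a+b+1). *)
Lemma jacobi_norm a b n : -1 < a -> -1 < b -> 0 < a + b + 1 ->
  jint a b (jacobi a b n * jacobi a b n) =
  (2 `^ (a + b + 1) * Gamma (n%:R + a + 1) * Gamma (n%:R + b + 1)) /
  ((2 * n%:R + a + b + 1) * n`!%:R * Gamma (n%:R + a + b + 1)).
Proof.
elim: n a b => [|n IH] a b a1 b1 ab0.
  rewrite jacobi_zero// mulr1 jint1// fact0 mulr0 !add0r mulr1.
  have -> : a + b + 2 = a + b + 1 + 1 by ring.
  by rewrite (Gamma_succ ab0) !mulrA. 
have n0 : 0 <= n%:R :> R := ler0n _ _.
have nS : n.+1%:R != 0 :> R by rewrite pnatr_eq0.
have nf : n`!%:R != 0 :> R by rewrite pnatr_eq0 -lt0n fact_gt0.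
have abn : 0 < n%:R + a + b + 2 by lra.
rewrite jacobi_norm_succ// IH; [|lra..].
have -> : n%:R + (a + 1) + 1 = n.+1%:R + a + 1 by rewrite -natr1; ring.
have -> : n%:R + (b + 1) + 1 = n.+1%:R + b + 1 by rewrite -natr1; ring.
have -> : n%:R + (a + 1) + (b + 1) + 1 = n%:R + a + b + 2 + 1 by ring.
have -> : n.+1%:R + a + b + 1 = n%:R + a + b + 2 by rewrite -natr1; ring.
have -> : a + 1 + (b + 1) + 1 = a + b + 1 + 1 + 1 by ring.
have pS x : 2 `^ (x + 1) = 2 * 2 `^ x :> R.
  by rewrite powRD ?powRr1 1?mulrC// pnatr_eq0 implybT.
rewrite !pS (Gamma_succ abn) factS natrM -natr1.
have G0 := Gamma_gt0 abn.
move: (Gamma _) (Gamma _) (Gamma _) (2 `^ _) G0 => G1 G2 G3 P G30.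
field; rewrite nf !gt_eqF//; lra.
Qed.

End jacobi_polynomials.

(** * Expansion coefficients and the matrices of the method *)

Section expansions.
Context {R : realType}.
Implicit Types (a b : R) (p q : {poly R}) (f g : R -> R).

Lemma imx_mul_fin (A B : imx R) i j M :
  (forall m, (M <= m)%N -> A i m * B m j = 0) ->
  imx_mul A B i j = \sum_(m < M) A i m * B m j.
Proof.
move=> AB0; apply/cvg_lim => //; apply: cvg_near_cst; exists M => // n /= Mn.
rewrite -(big_mkord xpredT (fun m => A i m * B m j)) (big_cat_nat (leq0n M) Mn)/=.
rewrite big_mkord [X in _ + X = _]big_nat_cond [X in _ + X = _]big1 ?addr0//.
by move=> m /andP[/andP[/AB0]].
Qed.

(** Near x, g_0(y) is the difference quotient times y - x, plus g_0(x). The limit is punctured, so y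
    = x is treated separately at the end. *)
Lemma smooth_within_continuous f : smooth_on_segment f -> {within `[-1, 1], continuous f}.
Proof.
move=> [g [gf dg]]; apply/subspace_continuousP => x xI.
have x11 : -1 <= x <= 1 by move: xI; rewrite /= in_itv.
have dgx := dg 0%N x x11; set F := within _ _ in dgx.
have FF : Filter F by exact: within_filter.
have cyx : (fun y => y - x) @ F --> (0 : R).
  rewrite -(subrr x); apply: cvgB; last exact: cvg_cst.
  by apply: cvg_within_filter; apply: cvg_within_filter; exact: cvg_id.
have cg : g 0%N y @[y --> F] --> g 0%N x.
  have -> : g 0%N x = g 1%N x * 0 + g 0%N x by rewrite mulr0 add0r.
  apply: cvg_trans (cvgD (cvgM dgx cyx) (cvg_cst (g 0%N x))).
  apply: near_eq_cvg; rewrite /F !near_withinE; apply: nearW => y yx _.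
  by rewrite !fctE/= divfK ?subrK// subr_eq0.
move: cg => /cvgrPdist_lt cg; apply/cvgrPdist_lt => e e0; have := cg e e0.
rewrite /F !near_withinE; apply: filterS => y gxy yI.
have y11 : -1 <= y <= 1 by move: yI; rewrite /= in_itv.
rewrite /from_subspace -!gf//; have [->|yx] := eqVneq y x; last exact: gxy.
by rewrite subrr normr0.
Qed.

Section fixed_weight.
Variables (a b : R).
Hypotheses (a1 : -1 < a) (b1 : -1 < b).
Local Notation J := (jacobi a b).
Local Notation h n := (jint a b (J n * J n)).

Lemma jacobi_expand n p : (size p <= n)%N ->
  p = \sum_(m < n) (jint a b (p * J m) / h m) *: J m.
Proof.
move=> /(graded_expand (size_jacobi a1 b1))[c pc].
rewrite [LHS]pc; apply: eq_bigr => m _; congr (_ *: _).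
rewrite pc mulr_suml jint_sum// (bigD1 m)//= big1 ?addr0 => [|l lm].
  by rewrite -scalerAl jintZ// mulfK// gt_eqF// jacobi_norm_gt0.
rewrite -scalerAl jintZ// jacobi_orth ?mulr0// => /ord_inj lm'.
by rewrite lm' eqxx in lm.
Qed.

Lemma jacobi_coefE f i : jacobi_coef a b f i = wint a b (fun x => f x * (J i).[x]) / h i.
Proof. by rewrite /jacobi_coef -jintE. Qed.

Lemma jacobi_coefK f i : wint a b (fun x => f x * (J i).[x]) = jacobi_coef a b f i * h i.
Proof. by rewrite jacobi_coefE divfK// gt_eqF// jacobi_norm_gt0. Qed.

Lemma jacobi_coefZ c f i : {within `[-1, 1], continuous f} ->
  jacobi_coef a b (fun x => c * f x) i = c * jacobi_coef a b f i.
Proof.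
move=> cf; rewrite !jacobi_coefE mulrA -wintZ//; last first.
  by apply: within_continuousM => //; exact: within_horner.
by congr (_ / _); apply: eq_wint => x _; rewrite mulrA.
Qed.

Lemma jacobi_coef_sum n (F : nat -> R -> R) i :
  (forall k, (k < n)%N -> {within `[-1, 1], continuous (F k)}) ->
  jacobi_coef a b (fun x => \sum_(k < n) F k x) i = \sum_(k < n) jacobi_coef a b (F k) i.
Proof.
move=> cF; rewrite jacobi_coefE.
under eq_bigr do rewrite jacobi_coefE.
rewrite -mulr_suml -wint_sum//; last first.
  by move=> k; apply: within_continuousM; [exact: cF|exact: within_horner].
by congr (_ / _); apply: eq_wint => x _; rewrite mulr_suml.
Qed.

(* [J^(a+1,b+1)_i] times the ratio [1 - x^2] of the two weights is a
   combination of [J^(a,b)_m], [m <= i + 2], with the coefficients of the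
   connection matrix rescaled by the norms; so no series is involved. *)
Lemma jacobi_coef_succ f i : {within `[-1, 1], continuous f} ->
  jacobi_coef (a + 1) (b + 1) f i = \sum_(m < i.+3)
    jacobi_coef (a + 1) (b + 1) (horner (J m)) i * jacobi_coef a b f m.
Proof.
move=> cf; set J1 := jacobi (a + 1) (b + 1); pose g := (1 - 'X^2) * J1 i.
have a1' : -1 < a + 1 by rewrite ltr_wpDr.
have b1' : -1 < b + 1 by rewrite ltr_wpDr.
have sg : (size g <= i.+3)%N.
  apply: (leq_trans (size_polyMleq _ _)); rewrite size_jacobi// addnS/=.
  rewrite -[i.+3]/(3 + i)%N leq_add2r (leq_trans (size_polyD _ _))//.
  by rewrite size_polyN size_polyXn size_poly1.
rewrite /jacobi_coef weighted_dotE wint_shiftl// wint_shiftr//.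
under eq_bigr => m _.
  rewrite jintE jint_shift// -/J1; over.
have -> : wint a b (fun x => f x * (J1 i).[x] * (1 - x) * (1 + x)) =
    wint a b (fun x => f x * g.[x]).
  by apply: eq_wint => x _; rewrite /g hornerM hornerD hornerN hornerC hornerXn; ring.
have -> : wint a b (fun x => f x * g.[x]) = wint a b
    (fun x => \sum_(m < i.+3) (jint a b (g * J m) / h m) * (f x * (J m).[x])).
  apply: eq_wint => x _; rewrite [in LHS](jacobi_expand sg) horner_sum mulr_sumr.
  by apply: eq_bigr => m _; rewrite hornerZ; ring.
rewrite wint_sum// => [|m].
  rewrite mulr_suml; apply: eq_bigr => m _.
  rewrite wintZ//; last by apply: within_continuousM => //; exact: within_horner.
  (* The same integral is the numerator of the connection coefficient and of the coefficient of
     [J m] in the expansion of [g]. *)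
  have -> : (1 - 'X^2) * (J m * J1 i) = g * J m by rewrite mulrCA mulrC.
  rewrite (jintE a b (J m) (J m)) (weighted_dotE a b f).
  by move: (jint _ _ _) (jint _ _ _) (wint _ _ _) (weighted_dot _ _ _) => *; ring.
apply: within_continuousM; first exact: within_cst.
by apply: within_continuousM => //; exact: within_horner.
Qed.

(** For the lower weight, J_m is paired with (1 - x^2) times the shifted polynomial of degree i, of
    degree i + 2 < m. *)
Lemma jacobi_coef_succ0 i m : (i.+3 <= m)%N ->
  jacobi_coef (a + 1) (b + 1) (horner (J m)) i = 0.
Proof.
move=> im; rewrite /jacobi_coef jintE jint_shift// mulrCA jacobi_orth_below ?mul0r//.
apply: leq_trans im; apply: (leq_trans (size_polyMleq _ _)).
rewrite size_jacobi ?ltr_wpDr// addnS/=.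
rewrite -[i.+3]/(3 + i)%N leq_add2r (leq_trans (size_polyD _ _))//.
by rewrite size_polyN size_polyXn size_poly1.
Qed.

End fixed_weight.
End expansions.

(** * Differentiation, multiplication and connection matrices in terms of Jacobi coefficients *)

Lemma jacobi_D0 (R : realType) (a b : R) k i j : j != (i + k)%N -> jacobi_D a b k i j = 0.
Proof.
rewrite /jacobi_D; have [->|k0] := eqVneq k 0%N => ij; last by rewrite (negbTE ij).
by rewrite addn0 in ij; rewrite /imx1 eq_sym (negbTE ij).
Qed.

(** Puts the identity convention for k = 0 under the general formula: there both Gamma arguments
    coincide, and positivity makes the quotient 1. *)
Lemma jacobi_DE (R : realType) (a b : R) k i : 0 < a + b + k%:R + i%:R + 1 ->
  jacobi_D a b k i (i + k)%N =
  2 ^- k * (Gamma (a + b + (2 * k)%:R + i%:R + 1) / Gamma (a + b + k%:R + i%:R + 1)).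
Proof.
move=> ki; rewrite /jacobi_D; have [k0|k0] := eqVneq k 0%N; last by rewrite eqxx.
move: ki; rewrite k0 addn0/= /imx1 eqxx muln0 expr0 invr1 mul1r => ki.
by rewrite divff// gt_eqF// Gamma_gt0.
Qed.

Lemma imx_mul_D (R : realType) (a b : R) (X : imx R) k i j : imx_mul X (jacobi_D a b k) i j =
  if (k <= j)%N then X i (j - k)%N * jacobi_D a b k (j - k)%N j else 0.
Proof.
rewrite (@imx_mul_fin _ _ _ _ _ j.+1); last first.
  by move=> m jm; rewrite jacobi_D0 ?mulr0//; apply/eqP; lia.
case: leqP => kj; last first.
  by apply: big1 => m _; rewrite jacobi_D0 ?mulr0//; apply/eqP; lia.
have jk : (j - k < j.+1)%N by rewrite ltnS leq_subr.
rewrite (bigD1 (Ordinal jk))//= big1 ?addr0// => m; rewrite -val_eqE/= => mjk.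
by rewrite jacobi_D0 ?mulr0//; apply/eqP; move/eqP: mjk; lia.
Qed.

Section stencils.
Context {R : realType}.
Variables (a b : R).
Hypotheses (a1 : -1 < a) (b1 : -1 < b).
Implicit Types (f : R -> R).

Let ak k : -1 < a + k%:R. Proof. by rewrite ltr_wpDr. Qed.
Let bk k : -1 < b + k%:R. Proof. by rewrite ltr_wpDr. Qed.

Lemma jacobi_SprodS k N : (k <= N)%N ->
  jacobi_Sprod a b k N.+1 = imx_mul (jacobi_S a b N) (jacobi_Sprod a b k N).
Proof.
move=> kN; rewrite /jacobi_Sprod /index_iota subSn// -addn1 iotaD rev_cat/= subnKC//.
by rewrite big_cons.
Qed.

Lemma jacobi_S0 k i m : (i.+3 <= m)%N -> jacobi_S a b k i m = 0.
Proof. by move=> im; rewrite /jacobi_S -natr1 !addrA jacobi_coef_succ0. Qed.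

(** Each of the [d] factors adds two superdiagonals. *)
Lemma jacobi_Sprod0 k d i m : (i + d.*2 < m)%N -> jacobi_Sprod a b k (k + d) i m = 0.
Proof.
elim: d i m => [|d IH] i m im.
  rewrite addn0 /jacobi_Sprod /index_iota subnn big_nil /imx1 ltn_eqF//.
  by rewrite addn0 in im.
rewrite addnS jacobi_SprodS ?leq_addr// (@imx_mul_fin _ _ _ _ _ i.+3); last first.
  by move=> l il; rewrite jacobi_S0 ?mul0r.
apply: big1 => l _; rewrite IH ?mulr0//.
by have := ltn_ord l; lia.
Qed.

(** Iterates [jacobi_coef_succ]. The cutoff [M] is any bound beyond the band, so that one [M] serves
    all rows l <= i + 2 met in the induction. *)
Lemma jacobi_Sprod_coef k d f i M : {within `[-1, 1], continuous f} ->
  (i + d.*2 < M)%N ->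
  jacobi_coef (a + (k + d)%:R) (b + (k + d)%:R) f i = \sum_(m < M)
    jacobi_Sprod a b k (k + d) i m * jacobi_coef (a + k%:R) (b + k%:R) f m.
Proof.
move=> cf; elim: d i M => [|d IH] i M iM.
  have iM' : (i < M)%N by move: iM; rewrite addn0.
  rewrite addn0 /jacobi_Sprod /index_iota subnn big_nil (bigD1 (Ordinal iM'))//=.
  rewrite /imx1 eqxx mul1r big1 ?addr0// => m; rewrite -val_eqE/= => mi.
  by rewrite eq_sym (negbTE mi) mul0r.
rewrite addnS -natr1 !addrA jacobi_coef_succ// jacobi_SprodS ?leq_addr//.
transitivity (\sum_(l < i.+3) \sum_(m < M) jacobi_S a b (k + d) i l *
  (jacobi_Sprod a b k (k + d) l m * jacobi_coef (a + k%:R) (b + k%:R) f m)).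
  apply: eq_bigr => l _; rewrite -mulr_sumr /jacobi_S -natr1 !addrA; congr (_ * _).
  by apply: IH; have := ltn_ord l; lia.
rewrite exchange_big; apply: eq_bigr => m _.
rewrite (@imx_mul_fin _ _ _ _ _ i.+3) ?mulr_suml; last first.
  by move=> l il; rewrite jacobi_S0 ?mul0r.
by apply: eq_bigr => l _; rewrite mulrA.
Qed.

(** Column [l] of M_k[f] lists the level k coefficients of f J_l, and the connection matrices lift
    them to level N by finite sums, without convergence of the expansion of f J_l. *)
Lemma jacobi_Sprod_M k N f i l : (k <= N)%N -> {within `[-1, 1], continuous f} ->
  imx_mul (jacobi_Sprod a b k N) (jacobi_M a b k f) i l =
  jacobi_coef (a + N%:R) (b + N%:R)
    (fun x => f x * (jacobi (a + k%:R) (b + k%:R) l).[x]) i.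
Proof.
move=> /subnKC <- cf; set d := (N - k)%N.
rewrite (@imx_mul_fin _ _ _ _ _ (i + d.*2).+1); last first.
  by move=> m im; rewrite jacobi_Sprod0 ?mul0r.
rewrite (@jacobi_Sprod_coef k d _ i (i + d.*2).+1)//.
by apply: within_continuousM => //; exact: within_horner.
Qed.

Lemma derivn_jacobi k i : (jacobi a b (i + k)%N)^`(k) =
  jacobi_D a b k i (i + k)%N *: jacobi (a + k%:R) (b + k%:R) i.
Proof.
elim: k i => [|k IH] i.
  by rewrite derivn0 addn0 /jacobi_D/= /imx1 eqxx scale1r !addr0.
rewrite derivnS -addSnnS IH derivZ deriv_jacobi// scalerA -!addrA !natr1; congr (_ *: _).
have ab : -2 < a + b by move: a1 b1; lra.
have i0 : 0 <= i%:R :> R := ler0n _ _.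
have k0 : 0 <= k%:R :> R := ler0n _ _.
(* The row index here is i + 1, which keeps the Gamma argument positive even when k = 0 and a + b is
   close to -2. *)
rewrite jacobi_DE; last by rewrite -natr1; lra.
rewrite addSnnS jacobi_DE; last by rewrite -natr1; lra.
have -> : a + b + (2 * k.+1)%:R + i%:R + 1 = a + b + (2 * k)%:R + i.+1%:R + 1 + 1.
  by rewrite mulnS natrD -[i.+1%:R]natr1; ring.
have -> : a + b + k.+1%:R + i%:R + 1 = a + b + k%:R + i.+1%:R + 1.
  by rewrite -!natr1; ring.
have p0 : 0 < a + b + (2 * k)%:R + i.+1%:R + 1 by rewrite natrM -natr1; lra.
rewrite (Gamma_succ p0).
have q0 : 0 < a + b + k%:R + i.+1%:R + 1 by rewrite -natr1; lra.
have := Gamma_gt0 q0; move: (Gamma _) (Gamma _) => G1 G2 G10.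
rewrite exprS natrM -natr1 invfM; field.
by rewrite gt_eqF//= expf_neq0// gt_eqF//; lra.
Qed.

Lemma horner_derivn_jacobi k j x : (jacobi a b j)^`(k).[x] =
  if (k <= j)%N then jacobi_D a b k (j - k)%N j *
    (jacobi (a + k%:R) (b + k%:R) (j - k)).[x] else 0.
Proof.
case: leqP => kj; last by rewrite derivn_poly0 ?horner0// size_jacobi.
by rewrite -{1}(subnK kj) derivn_jacobi hornerZ subnK.
Qed.

Lemma jacobi_coef_diff_term N k f i j : (k <= N)%N -> {within `[-1, 1], continuous f} ->
  imx_mul (imx_mul (jacobi_Sprod a b k N) (jacobi_M a b k f)) (jacobi_D a b k) i j =
  jacobi_coef (a + N%:R) (b + N%:R) (fun x => f x * (jacobi a b j)^`(k).[x]) i.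
Proof.
move=> kN cf; rewrite imx_mul_D.
(* The scalar is the only entry of column [j] of D_k; for j < k the column and the derivative both
   vanish. *)
have -> : (fun x => f x * (jacobi a b j)^`(k).[x]) =
    (fun x => (if (k <= j)%N then jacobi_D a b k (j - k)%N j else 0) *
       (f x * (jacobi (a + k%:R) (b + k%:R) (j - k)).[x])).
  by apply/funext => x; rewrite horner_derivn_jacobi; case: ifP => _; ring.
rewrite jacobi_coefZ//; last by apply: within_continuousM => //; exact: within_horner.
by rewrite -jacobi_Sprod_M//; case: ifP => _; [exact: mulrC|rewrite mul0r].
Qed.

End stencils.

(** * Norms, the matrix of the differential operator, and assembly *)

Lemma jacobi_dE (R : realType) (a b : R) N j : -1 < a -> -1 < b -> (0 < N)%N ->
  jacobi_d a b N j =
  jint (a + N%:R) (b + N%:R)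
    (jacobi (a + N%:R) (b + N%:R) j * jacobi (a + N%:R) (b + N%:R) j).
Proof.
move=> a1 b1 N0; have N1 : 1 <= N%:R :> R by rewrite ler1n.
(* From N >= 1 the shifted parameters satisfy a + b + 2N + 1 > 0, as [jacobi_norm] requires. *)
rewrite jacobi_norm; [|lra..]; rewrite /jacobi_d !natrM.
have -> : a + b + 2 * N%:R + 1 = a + N%:R + (b + N%:R) + 1 by ring.
have -> : 2 * j%:R + a + b + 2 * N%:R + 1 = 2 * j%:R + (a + N%:R) + (b + N%:R) + 1 by ring.
have -> : j%:R + a + b + 2 * N%:R + 1 = j%:R + (a + N%:R) + (b + N%:R) + 1 by ring.
by rewrite !(addrA j%:R).
Qed.

Lemma diff_op_horner (R : realType) N (c : nat -> R -> R) (p : {poly R}) x :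
  diff_op N c (horner p) x = \sum_(k < N.+1) c k x * p^`(k).[x].
Proof.
have dp k : derive1n k (horner p) = horner p^`(k).
  by elim: k => [//|k IH]; rewrite derive1nS derivnS derivE -IH.
by apply: eq_bigr => k _; rewrite dp.
Qed.

Lemma diff_op_recombine (R : realType) N (c : nat -> R -> R) m n
    (J : nat -> {poly R}) (C : 'M[R]_(m, n)) (j : 'I_n) x :
  diff_op N c (horner (recombine J C j)) x =
  \sum_(q < m) C q j * diff_op N c (horner (J q)) x.
Proof.
rewrite diff_op_horner; under [RHS]eq_bigr do rewrite diff_op_horner mulr_sumr.
rewrite exchange_big; apply: eq_bigr => k _.
rewrite /recombine raddf_sum horner_sum mulr_sumr; apply: eq_bigr => q _.
by rewrite /= derivnZ hornerZ mulrCA.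
Qed.

(** By linearity of the coefficients: each summand of [jacobi_L] gives the level N coefficients of
    one term c_k (J_j)^(k). *)
Lemma jacobi_LE (R : realType) (a b : R) N (c : nat -> R -> R) i j :
  -1 < a -> -1 < b ->
  (forall k, (k <= N)%N -> {within `[-1, 1], continuous (c k)}) ->
  jacobi_L a b N c i j =
  jacobi_coef (a + N%:R) (b + N%:R) (diff_op N c (horner (jacobi a b j))) i.
Proof.
move=> a1 b1 cc.
have aN : -1 < a + N%:R by rewrite ltr_wpDr.
have bN : -1 < b + N%:R by rewrite ltr_wpDr.
have -> : diff_op N c (horner (jacobi a b j)) =
    (fun x => \sum_(k < N.+1) c k x * (jacobi a b j)^`(k).[x]).
  by apply/funext => x; rewrite diff_op_horner.
rewrite (@jacobi_coef_sum _ _ _ aN bN _ (fun k x => c k x * (jacobi a b j)^`(k).[x])); last first.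
  by move=> k kN; apply: within_continuousM; [exact: cc|exact: within_horner].
rewrite big_ord_recr/= [RHS]addrC /jacobi_L; congr (_ + _).
  (* The leading term is the case k = N, in which the product of connection matrices is empty and is
     removed again by [jacobi_Sprod_M]. *)
  rewrite -(jacobi_coef_diff_term a1 b1 i j (leqnn N) (cc _ (leqnn N))) !imx_mul_D.
  case: ifP => // _; congr (_ * _).
  by rewrite (jacobi_Sprod_M a1 b1)//; exact: cc.
apply: eq_bigr => k _; apply: jacobi_coef_diff_term => //; [exact: ltnW|].
by apply: cc; exact: ltnW.
Qed.

Theorem lemma5p1 (R : realType) (N n : nat) (hN : (1 <= N)%N) (hn : (1 <= n)%N)
    (alpha beta : R) (halpha : -1 < alpha) (hbeta : -1 < beta)
    (a : nat -> R -> R)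
    (ha : forall k : nat, (k <= N)%N -> smooth_on_segment (a k))
    (haN : forall x : R, -1 <= x <= 1 -> a N x != 0)
    (RJ QJ : 'M[R]_(n + N, n)) :
  let phi := recombine (jacobi alpha beta) RJ in
  let psi := recombine (jacobi (alpha + N%:R) (beta + N%:R)) QJ in
  let omega := jacobi_weight (alpha + N%:R) (beta + N%:R) in
  petrov_galerkin_mx omega (diff_op N a) psi phi =
  QJ^T *m jacobi_Omega alpha beta N (n + N)
       *m imx_trunc (n + N) (jacobi_L alpha beta N a) *m RJ.
Proof.
move=> phi psi omega.
have ac k : (k <= N)%N -> {within `[-1, 1], continuous (a k)}.
  by move=> kN; apply: smooth_within_continuous; exact: ha.
have aN : -1 < alpha + N%:R by rewrite ltr_wpDr.
have bN : -1 < beta + N%:R by rewrite ltr_wpDr.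
pose J0 := jacobi alpha beta; pose J1 := jacobi (alpha + N%:R) (beta + N%:R).
have Lc p : {within `[-1, 1], continuous (diff_op N a (horner p))}.
  have -> : diff_op N a (horner p) = (fun x => \sum_(k < N.+1) a k x * p^`(k).[x]).
    by apply/funext => x; rewrite diff_op_horner.
  apply: within_sum => k; apply: within_continuousM; last exact: within_horner.
  by apply: ac; rewrite -ltnS.
apply/matrixP => i j; rewrite !mxE.
(* Bilinearity reduces the entry to the pairings of the operator applied to J_q with the level N
   polynomials; the integrals are linear because all integrands are continuous. *)
transitivity (\sum_(q < n + N) \sum_(p < n + N) QJ p i * RJ q j *
    wint (alpha + N%:R) (beta + N%:R)
      (fun x => diff_op N a (horner (J0 q)) x * (J1 p).[x])).
  have Lq q p : {within `[-1, 1], continuous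
      (fun x => diff_op N a (horner (J0 q)) x * (J1 p).[x])}.
    by apply: within_continuousM; [exact: Lc|exact: within_horner].
  have cLq c q p : {within `[-1, 1], continuous
      (fun x => c * (diff_op N a (horner (J0 q)) x * (J1 p).[x]))}.
    by apply: within_continuousM; [exact: within_cst|exact: Lq].
  under eq_bigr => q _ do under eq_bigr => p _ do rewrite -(wintZ aN bN _ (Lq q p)).
  under eq_bigr => q _ do rewrite -wint_sum//.
  rewrite -wint_sum//; last by move=> q; exact: within_sum.
  apply: eq_wint => x _; rewrite /psi /phi diff_op_recombine mulr_sumr.
  apply: eq_bigr => q _; rewrite /recombine horner_sum mulr_suml.
  by apply: eq_bigr => p _; rewrite hornerZ -/J0 -/J1; ring.
apply: eq_bigr => q _; rewrite !mxE mulr_suml; apply: eq_bigr => p _.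
(* Each pairing is an expansion coefficient times a squared norm, that is, an entry of L times a
   diagonal entry of Omega. *)
rewrite jacobi_coefK// -jacobi_dE// mul_mx_diag !mxE jacobi_LE//; ring.
Qed.
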